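(* Let $\mu,\nu$ be probability measures on $\mathbb{R}^d$ with compact supports and $\mu\ll\mathcal{L}^d$. Let $c:\mathbb{R}^d\times\mathbb{R}^d\to\mathbb{R}^+$ be continuous and satisfy: (i) for every $x$ there is a unique $y$ with $c(x,y)=0$, and for every $y$, $\inf_x c(x,y)=0$; (ii) for every $y$, $c(\cdot,y)$ is strictly quasiconvex; (iii) for all $\lambda>0$ and $y$, the set $\{z:c(z,y)\le\lambda\}$ has $C^1$ boundary; (iv) for all $x,y,\tilde y$ and $\lambda>0$: if $c(x,y)=c(x,\tilde y)=\lambda$ and $n_{c(\cdot,y)}(x)=n_{c(\cdot,\tilde y)}(x)$ then $y=\tilde y$. Assume $\nu(\{y_0\})>0$ for some $y_0\in\mathbb{R}^d$. Let $T$ and $\tilde T$ be optimal transport maps (Borel maps pushing $\mu$ to $\nu$, optimal for the problem $\min_{\gamma\in\Pi(\mu,\nu)}\gamma\text{-}\operatorname{ess\,sup}c$) corresponding respectively to $\infty$-$c$-cyclically monotone transport plans $\gamma=(\mathrm{Id}\times T)_\sharp\mu$ and $\tilde\gamma=(\mathrm{Id}\times\tilde T)_\sharp\mu$. Then $$\mu\big(T^{-1}(\{y_0\})\setminus\tilde T^{-1}(\{y_0\})\big)=0.$$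
   Context: $\Pi(\mu,\nu)$ is the set of Borel probability measures on $\mathbb{R}^d\times\mathbb{R}^d$ with marginals $\mu,\nu$. Strict quasiconvexity of $c(\cdot,y)$ means $c((1-t)x+t\bar x,y)<\max\{c(x,y),c(\bar x,y)\}$ for all $t\in(0,1)$ and $x\neq\bar x$. For $c(x,y)=\lambda>0$, $n_{c(\cdot,y)}(x)$ is the unit outer normal at $x$ to $\{z:c(z,y)\le\lambda\}$. A set $\Gamma\subset\mathbb{R}^d\times\mathbb{R}^d$ is $\infty$-$c$-cyclically monotone if for every finite family $\{(x_i,y_i)\}_{i=1}^k\subset\Gamma$ and every permutation $\sigma$ of $\{1,\dots,k\}$, $\max_i c(x_i,y_i)\le\max_i c(x_i,y_{\sigma(i)})$; a plan is $\infty$-$c$-cyclically monotone if it is concentrated on such a set. *)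

(* Defs.v *)
From HB Require Import structures.
From mathcomp Require Import all_boot all_order all_algebra.
From mathcomp Require Import all_classical all_reals all_analysis.
From mathcomp Require Import ess_sup_inf fingroup perm.
Set Implicit Arguments. Unset Strict Implicit. Unset Printing Implicit Defensive.
Import Order.TTheory GRing.Theory Num.Def Num.Theory.
Import numFieldNormedType.Exports.
Local Open Scope classical_set_scope.
Local Open Scope ring_scope.

Definition borelRd (R : realType) (d : nat) :=
  g_sigma_algebraType (@open 'rV[R]_d).

Definition enorm (R : realType) (d : nat) (v : 'rV[R]_d) : R :=
  Num.sqrt (\sum_(i < d) v ord0 i ^+ 2).

Definition box (R : realType) (d : nat) (a b : 'rV[R]_d) : set 'rV[R]_d :=
  [set x | forall i, a ord0 i <= x ord0 i <= b ord0 i].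
Definition box_vol (R : realType) (d : nat) (a b : 'rV[R]_d) : R :=
  \prod_(i < d) maxr 0 (b ord0 i - a ord0 i).

Definition lebesgue_null (R : realType) (d : nat) (N : set 'rV[R]_d) : Prop :=
  forall eps : R, 0 < eps ->
    exists a b : nat -> 'rV[R]_d,
      N `<=` \bigcup_k box (a k) (b k) /\
      (\sum_(0 <= k <oo) (box_vol (a k) (b k))%:E < eps%:E)%E.

Definition abs_cont_lebesgue (R : realType) (d : nat)
    (mu : probability (borelRd R d) R) : Prop :=
  forall A : set (borelRd R d), measurable A -> lebesgue_null A -> mu A = 0%E.

Definition msupport (R : realType) (d : nat)
    (mu : probability (borelRd R d) R) : set 'rV[R]_d :=
  [set x | forall r : R, 0 < r -> (0 < mu (ball x r))%E].

Definition is_plan (R : realType) (d : nat)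
    (mu nu : probability (borelRd R d) R)
    (gamma : probability (borelRd R d * borelRd R d)%type R) : Prop :=
  (forall A : set (borelRd R d), measurable A -> gamma (A `*` setT) = mu A) /\
  (forall A : set (borelRd R d), measurable A -> gamma (setT `*` A) = nu A).

Definition cost_esssup (R : realType) (d : nat) (c : 'rV[R]_d -> 'rV[R]_d -> R)
    (gamma : probability (borelRd R d * borelRd R d)%type R) : \bar R :=
  ess_sup gamma (fun p => (c p.1 p.2)%:E).

Definition inf_c_cyc_mon_set (R : realType) (d : nat)
    (c : 'rV[R]_d -> 'rV[R]_d -> R) (G : set ('rV[R]_d * 'rV[R]_d)) : Prop :=
  forall (k : nat) (p : 'I_k -> 'rV[R]_d * 'rV[R]_d) (s : {perm 'I_k}),
    (forall i, G (p i)) ->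
    \big[maxr/0]_(i < k) c (p i).1 (p i).2 <=
    \big[maxr/0]_(i < k) c (p i).1 (p (s i)).2.

Definition inf_c_cyc_mon_plan (R : realType) (d : nat)
    (c : 'rV[R]_d -> 'rV[R]_d -> R)
    (gamma : probability (borelRd R d * borelRd R d)%type R) : Prop :=
  exists G : set ('rV[R]_d * 'rV[R]_d),
    inf_c_cyc_mon_set c G /\ gamma.-negligible (~` G).

Definition strictly_quasiconvex (R : realType) (d : nat) (f : 'rV[R]_d -> R) :=
  forall (x xb : 'rV[R]_d) (t : R), 0 < t < 1 -> x != xb ->
    f ((1 - t) *: x + t *: xb) < maxr (f x) (f xb).

Definition partial (R : realType) (d : nat) (phi : 'rV[R]_d -> R) (i : 'I_d)
  (x : 'rV[R]_d) : R := 'D_(delta_mx 0 i) phi x.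
Definition C1 (R : realType) (d : nat) (phi : 'rV[R]_d -> R) : Prop :=
  (forall x i, derivable phi x (delta_mx 0 i)) /\
  (forall i, continuous (partial phi i)).
Definition grad (R : realType) (d : nat) (phi : 'rV[R]_d -> R) (x : 'rV[R]_d)
  : 'rV[R]_d := \row_i partial phi i x.

Definition C1_chart (R : realType) (d : nat) (K : set 'rV[R]_d)
    (x : 'rV[R]_d) (phi : 'rV[R]_d -> R) (r : R) : Prop :=
  [/\ C1 phi, 0 < r, phi x = 0, grad phi x != 0 &
      forall z, ball x r z -> (K z <-> phi z <= 0)].

Definition C1_boundary (R : realType) (d : nat) (K : set 'rV[R]_d) : Prop :=
  forall x, closure K x -> ~ (interior K) x ->
    exists (phi : 'rV[R]_d -> R) (r : R), C1_chart K x phi r.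

Definition outer_normal (R : realType) (d : nat) (K : set 'rV[R]_d)
    (x n : 'rV[R]_d) : Prop :=
  exists (phi : 'rV[R]_d -> R) (r : R),
    C1_chart K x phi r /\ n = (enorm (grad phi x))^-1 *: grad phi x.

Definition sublevel (R : realType) (d : nat) (c : 'rV[R]_d -> 'rV[R]_d -> R)
  (y : 'rV[R]_d) (lam : R) : set 'rV[R]_d := [set z | c z y <= lam].

(* Main.v *)
(* Let [x] be sent to [T x] by the first map and [x'] to [Tt x'] by the second one, and
   call the pair improvable if exchanging the two targets strictly decreases the larger
   cost. Improvable pairs can be chained when the target of [x'] is close enough to the
   target of the first point of the next pair, and two [oo]-cyclically monotone plans
   admit no closed chain. If [T x' <> Tt x'], the quasiconvexity of the cost and the
   condition on the normals give a cone with vertex [x'] all of whose points [x] with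
   [T x] close to [T x'] form an improvable pair with [x']; sets avoiding cones are
   Lipschitz graphs, hence Lebesgue null. Therefore the mass which leaves [y0] along
   [Tt] stays in a Borel set [V] of values reached by chains starting at [y0], and
   [~ V y0] since chains do not close. As [T] and [Tt] give the same mass to [V], no
   mass can enter [V] from [y0]. *)
Require Import Defs.
From HB Require Import structures.
From mathcomp Require Import all_boot all_order all_algebra.
From mathcomp Require Import all_classical all_reals all_analysis.
From mathcomp Require Import ess_sup_inf fingroup perm.
From mathcomp Require Import ring lra.
Import Order.TTheory GRing.Theory Num.Def Num.Theory.
Import numFieldNormedType.Exports.
Local Open Scope classical_set_scope.
Local Open Scope ring_scope.

(** * First-order expansion of [C1] functions *)

Lemma row_norm_leP (R : realType) (d : nat) (u : 'rV[R]_d) (e : R) :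
  0 <= e -> reflect (forall i, `|u ord0 i| <= e) (`|u| <= e).
Proof.
have -> : `|u| = \big[maxr/0]_ij `|u ij.1 ij.2| by rewrite {1}/normr/= mx_normrE.
move=> e0; apply: (iffP idP).
  by move=> /bigmax_leP[_ ue] i; exact: (ue (ord0, i)).
by move=> ue; apply/bigmax_leP; split => // -[j i] _; rewrite (ord1 j)/=.
Qed.

Lemma coord_le_norm (R : realType) (d : nat) (u : 'rV[R]_d) i : `|u ord0 i| <= `|u|.
Proof. by move: i; apply/row_norm_leP. Qed.

Lemma is_derive_partial (R : realType) (d : nat) (phi : 'rV[R]_d -> R)
    (z : 'rV[R]_d) (k : 'I_d) (s : R) :
  C1 phi ->
  is_derive s 1 (fun t : R => phi (z + t *: delta_mx 0 k))
    (partial phi k (z + s *: delta_mx 0 k)).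
Proof.
move=> [phiD _].
have E : (fun h : R => h^-1 *: (((fun t : R => phi (z + t *: delta_mx 0 k)) \o shift s)
            (h *: 1) - phi (z + s *: delta_mx 0 k))) =
         (fun h : R => h^-1 *: ((phi \o shift (z + s *: delta_mx 0 k))
            (h *: delta_mx 0 k) - phi (z + s *: delta_mx 0 k))).
  apply: funext => h /=; congr (_ *: (phi _ - _)).
  by rewrite scaler1 scalerDl addrCA.
split; first by rewrite /derivable E; exact: phiD.
by rewrite /derive E.
Qed.

Lemma partial_increment (R : realType) (d : nat) (phi : 'rV[R]_d -> R)
    (z : 'rV[R]_d) (k : 'I_d) (s l eps : R) :
  C1 phi ->
  (forall t : R, `|t| <= `|s| ->
    `|partial phi k (z + t *: delta_mx 0 k) - l| <= eps) ->
  `|phi (z + s *: delta_mx 0 k) - phi z - s * l| <= eps * `|s|.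
Proof.
move=> C1phi near_l.
pose g (t : R) := phi (z + t *: delta_mx 0 k).
have gD (t : R) : is_derive t 1 g (partial phi k (z + t *: delta_mx 0 k)).
  exact: is_derive_partial.
have gc (a b : R) : {within `[a, b], continuous g}.
  apply: continuous_subspaceT => t.
  by apply: differentiable_continuous; apply/derivable1_diffP; case: (gD t).
have g0 : g 0 = phi z by rewrite /g scale0r addr0.
rewrite -/(g s) -g0.
have [s0|/ltW s0] := leP 0 s.
  have [t t_in ->] := MVT_segment s0 (fun t _ => gD t) (gc 0 s).
  rewrite subr0 -mulrC -mulrBr normrM mulrC ler_wpM2r//; apply: near_l.
  by move: t_in; rewrite in_itv/= => /andP[t0 ts]; rewrite !ger0_norm.
have [t t_in E] := MVT_segment s0 (fun t _ => gD t) (gc s 0).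
rewrite -normrN; have -> : - (g s - g 0 - s * l) = g 0 - g s + s * l by ring.
rewrite E sub0r mulrN addrC [_ * s]mulrC -mulrBr normrM mulrC ler_wpM2r// distrC.
apply: near_l.
by move: t_in; rewrite in_itv/= => /andP[ts t0]; rewrite !ler0_norm// lerN2.
Qed.

(** [C1] speaks of partial derivatives only, so the increment is split into moves along one
    coordinate at a time; by the mean value theorem each move contributes an error of at most [eps]
    times its length. *)
Lemma C1_increment (R : realType) (d : nat) (phi : 'rV[R]_d -> R)
    (x : 'rV[R]_d) (eps : R) :
  C1 phi -> 0 < eps ->
  \forall u \near (0 : 'rV[R]_d),
    `|phi (x + u) - phi x - \sum_i u ord0 i * partial phi i x|
      <= eps * \sum_i `|u ord0 i|.
Proof.
move=> C1phi eps0.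
have: \forall z \near x, forall i, `|partial phi i z - partial phi i x| < eps.
  apply: (@filter_forall _ _ (fun i z => `|partial phi i z - partial phi i x| < eps) (nbhs x) _) => i.
  have [_ /(_ i x) /cvgrPdist_lt /(_ _ eps0)] := C1phi.
  by apply: filterS => z; rewrite distrC.
case/nbhs_ballP => del /= del0 near_x.
apply/nbhs_ballP; exists del => //= u; rewrite -ball_normE/= sub0r normrN => u_lt.
(* [tr k] keeps the first [k] coordinates of [u]: these are the corners of a path from [0] to
   [u]. *)
pose tr k : 'rV[R]_d := \row_i (if (i < k)%N then u ord0 i else 0).
have trS (k : 'I_d) : tr k.+1 = tr k + u ord0 k *: delta_mx 0 k.
  apply/rowP => i; rewrite !mxE/= ltnS leq_eqVlt -val_eqE.
  case: ltngtP => ik; rewrite ?mulr0 ?addr0// mulr1 add0r.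
  by congr (u _ _); exact: val_inj.
have trd : tr d = u by apply/rowP => i; rewrite mxE ltn_ord.
suff: forall k, (k <= d)%N ->
    `|phi (x + tr k) - phi x - \sum_(i < d | (i < k)%N) u ord0 i * partial phi i x|
      <= eps * \sum_(i < d | (i < k)%N) `|u ord0 i|.
  move/(_ d (leqnn d)); rewrite trd.
  by congr (`| _ - _ | <= _ * _); apply: eq_bigl => i; rewrite ltn_ord.
elim=> [_|k IH kd].
  rewrite !big_pred0//; have -> : tr 0 = 0 by apply/rowP => i; rewrite !mxE.
  by rewrite addr0 subrr subrr normr0 mulr0.
pose K := Ordinal kd.
have split_sum (F : 'I_d -> R) :
    \sum_(i < d | (i < k.+1)%N) F i = \sum_(i < d | (i < k)%N) F i + F K.
  rewrite (bigD1 K) //= addrC; congr (_ + _); apply: eq_bigl => i.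
  by rewrite ltnS ltn_neqAle -val_eqE andbC.
rewrite !split_sum (trS K) addrA mulrDr.
have -> : phi (x + tr K + u ord0 K *: delta_mx 0 K) - phi x
    - (\sum_(i < d | (i < k)%N) u ord0 i * partial phi i x
       + u ord0 K * partial phi K x) =
  (phi (x + tr k) - phi x - \sum_(i < d | (i < k)%N) u ord0 i * partial phi i x) +
  (phi (x + tr K + u ord0 K *: delta_mx 0 K) - phi (x + tr K)
    - u ord0 K * partial phi K x) by rewrite /=; ring.
apply: le_trans (ler_normD _ _) _; apply: lerD; first exact/IH/ltnW.
apply: partial_increment => // t t_le; apply/ltW/near_x.
rewrite -ball_normE/= -addrA opprD addNKr normrN.
(* The path stays in the ball because the norm is the largest absolute coordinate. *)
apply: le_lt_trans u_lt; apply/row_norm_leP => // i; rewrite !mxE/= -val_eqE/=.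
case: ltngtP => ik; rewrite ?mulr0 ?addr0 ?normr0 ?mulr1 ?add0r ?coord_le_norm//.
exact: le_trans t_le (coord_le_norm _ _ _ _).
Qed.

(** * Strictly quasiconvex functions along lines *)

Lemma near_lt (R : realType) (U : topologicalType) (f g : U -> R) (p : U) :
  {for p, continuous f} -> {for p, continuous g} -> f p < g p ->
  \forall q \near p, f q < g q.
Proof.
move=> fc gc fg.
have /cvgr_lt : (fun q => f q - g q) @ p --> f p - g p by exact: cvgB.
move=> /(_ 0); rewrite subr_lt0 => /(_ fg).
by apply: filterS => q; rewrite subr_lt0.
Qed.

Lemma strictly_quasiconvex_ray (R : realType) (d : nat) (f : 'rV[R]_d -> R)
    (x v : 'rV[R]_d) (s t : R) :
  strictly_quasiconvex f -> f (x + t *: v) <= f x -> v != 0 -> 0 < s < t ->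
  f (x + s *: v) < f x.
Proof.
move=> fq ft v0 /andP[s0 st]; have t0 : 0 < t by exact: lt_trans st.
have := fq x (x + t *: v) (s / t).
have -> : (1 - s / t) *: x + (s / t) *: (x + t *: v) = x + s *: v.
  by rewrite scalerDr addrA -scalerDl subrK scale1r scalerA divfK ?gt_eqF.
rewrite (max_idPl ft); apply; first by rewrite divr_gt0//= ltr_pdivrMr// mul1r.
by rewrite -subr_eq0 opprD addNKr oppr_eq0 scaler_eq0 negb_or gt_eqF.
Qed.

(** [x] lies strictly between [x - w] and [x + t *: w], and the value at [x - w] is too small to be
    the dominating one. *)
Lemma strictly_quasiconvex_back (R : realType) (d : nat) (f : 'rV[R]_d -> R)
    (x w : 'rV[R]_d) (t : R) :
  strictly_quasiconvex f -> f (x - w) < f x -> 0 < t -> f x < f (x + t *: w).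
Proof.
move=> fq fw t0.
have w0 : w != 0 by apply: contraTneq fw => ->; rewrite subr0 ltxx.
have t1 : 0 < 1 + t by rewrite addr_gt0.
have := fq (x - w) (x + t *: w) (1 + t)^-1.
have -> : (1 - (1 + t)^-1) *: (x - w) + (1 + t)^-1 *: (x + t *: w) = x.
  apply/rowP => i; rewrite !mxE; field; exact: lt0r_neq0.
have s01 : 0 < (1 + t)^-1 < 1 by rewrite invr_gt0 t1/= invf_lt1// ltrDl.
have wt : x - w != x + t *: w.
  by rewrite -subr_eq0 opprD addrACA subrr add0r -opprD oppr_eq0
    -[X in X + _]scale1r -scalerDl scaler_eq0 negb_or gt_eqF.
move=> /(_ s01 wt); rewrite lt_max => /orP[|//].
by rewrite ltNge (ltW fw).
Qed.

Lemma near0_scale (R : realType) (d : nat) (v : 'rV[R]_d) (P : set 'rV[R]_d) :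
  (\forall u \near (0 : 'rV[R]_d), P u) -> \forall t \near 0^'+, P (t *: v).
Proof.
move=> P0; have : (fun t : R => t *: v) @ 0 --> 0 *: v.
  by apply: cvgZ => //; exact: cvg_cst.
by rewrite scale0r => /(_ _ P0); exact: cvg_at_right_filter.
Qed.

(** Makes a boundary chart available at [x]: an interior [x] would be the midpoint of two distinct
    points of its own sublevel set. Positive dimension provides the nonzero [u]. *)
Lemma strictly_quasiconvex_not_interior (R : realType) (n : nat)
    (f : 'rV[R]_n.+1 -> R) (x : 'rV[R]_n.+1) :
  strictly_quasiconvex f -> ~ interior [set z | f z <= f x] x.
Proof.
move=> fq /nbhs_ballP[r /= r0 rP].
pose u : 'rV[R]_n.+1 := const_mx (r / 2).
have un : `|u| < r.
  apply: (@le_lt_trans _ _ (r / 2)); last by rewrite ltr_pdivrMr// ltr_pMr// ltr1n.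
  have r2 : 0 < r / 2 by rewrite divr_gt0.
  by apply/row_norm_leP => [|i]; rewrite ?mxE ?gtr0_norm// ltW.
have u0 : u != 0.
  apply/eqP => /rowP/(_ 0); rewrite !mxE => /eqP.
  by rewrite mulf_eq0 invr_eq0 pnatr_eq0 orbF gt_eqF.
have fm : f (x - u) <= f x by apply: rP; rewrite -ball_normE/= opprB addrC subrK.
have fp : f (x + u) <= f x by apply: rP; rewrite -ball_normE/= opprD addNKr normrN.
have := fq (x - u) (x + u) 2^-1.
have -> : (1 - 2^-1) *: (x - u) + 2^-1 *: (x + u) = x.
  by apply/rowP => i; rewrite !mxE; field.
have s01 : 0 < (2^-1 : R) < 1 by rewrite invr_gt0 ltr0n/= invf_lt1 ?ltr1n ?ltr0n.
have uu : x - u != x + u.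
  rewrite -subr_eq0 opprD addrACA subrr add0r -opprD oppr_eq0 -mulr2n -scaler_nat.
  by rewrite scaler_eq0 pnatr_eq0.
by move=> /(_ s01 uu); rewrite lt_max !ltNge fm fp.
Qed.

(** * Descent directions and unit normals *)

Lemma chart_descent (R : realType) (d : nat) (K : set 'rV[R]_d)
    (x v : 'rV[R]_d) (phi : 'rV[R]_d -> R) (r : R) :
  C1_chart K x phi r -> \sum_i v ord0 i * partial phi i x < 0 ->
  exists2 t, 0 < t & K (x + t *: v).
Proof.
move=> [C1phi r0 phi0 _ KP] vphi.
set a := \sum_i _ in vphi; pose b := \sum_i `|v ord0 i|.
have b0 : 0 <= b by exact: sumr_ge0.
(* With this choice [eps * b] stays below [- a], so the linear term [t * a] absorbs the error
   [eps * (t * b)]. *)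
pose eps := - a / (1 + b).
have b1 : 0 < 1 + b by rewrite ltr_pwDl.
have eps0 : 0 < eps by rewrite divr_gt0// oppr_gt0.
have : \forall u \near (0 : 'rV[R]_d), `|u| < r.
  by apply/nbhs_ballP; exists r => //= u; rewrite -ball_normE/= sub0r normrN.
move=> /(near0_scale _ _ v) nr.
have /(near0_scale _ _ v) := C1_increment R d phi x eps C1phi eps0 => ninc.
near (0 : R)^'+ => t; exists t => //; apply/KP.
  by rewrite -ball_normE/= opprD addNKr normrN; near: t; exact: nr.
have t0 : 0 < t by [].
have inc : `|phi (x + t *: v) - phi x - \sum_i (t *: v) ord0 i * partial phi i x|
    <= eps * \sum_i `|(t *: v) ord0 i| by near: t; exact: ninc.
rewrite phi0 subr0 in inc.
have -> : phi (x + t *: v) = (phi (x + t *: v) - t * a) + t * a by rewrite subrK.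
have E1 : \sum_i (t *: v) ord0 i * partial phi i x = t * a.
  by rewrite mulr_sumr; apply: eq_bigr => i _; rewrite !mxE mulrA.
have E2 : \sum_i `|(t *: v) ord0 i| = t * b.
  by rewrite mulr_sumr; apply: eq_bigr => i _; rewrite !mxE normrM gtr0_norm.
have : phi (x + t *: v) - t * a <= eps * (t * b).
  rewrite -E1 -E2; exact: le_trans (ler_norm _) inc.
have : eps * (t * b) <= t * - a; last by lra.
rewrite mulrCA ler_pM2l// /eps mulrAC ler_pdivrMr// ler_pM2l ?oppr_gt0//; lra.
Unshelve. all: by end_near. Qed.

Lemma sum_sqr_gt0 (R : realType) (d : nat) (p : 'rV[R]_d) :
  p != 0 -> 0 < \sum_i p ord0 i ^+ 2.
Proof.
move=> p0; have sq i : true -> 0 <= p ord0 i ^+ 2 by rewrite sqr_ge0.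
rewrite lt_neqAle sumr_ge0// andbT eq_sym; apply: contra p0 => /eqP s0.
apply/eqP/rowP => i; rewrite mxE; apply/eqP; rewrite -sqrf_eq0.
by apply/eqP; exact: (psumr_eq0P sq).
Qed.

Lemma enorm_gt0 (R : realType) (d : nat) (p : 'rV[R]_d) : p != 0 -> 0 < enorm p.
Proof. by move=> p0; rewrite sqrtr_gt0 sum_sqr_gt0. Qed.

Lemma sum_sqr_normalized (R : realType) (d : nat) (p : 'rV[R]_d) :
  p != 0 -> \sum_i ((enorm p)^-1 *: p) ord0 i ^+ 2 = 1.
Proof.
move=> p0; under eq_bigr do rewrite mxE exprMn.
rewrite -mulr_sumr exprVn sqr_sqrtr ?ltW ?sum_sqr_gt0// mulVf// gt_eqF//.
exact: sum_sqr_gt0.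
Qed.

(** The witness is the difference of the two normalized vectors: distinct unit vectors have scalar
    product below 1. *)
Lemma separating_direction (R : realType) (d : nat) (p q : 'rV[R]_d) :
  p != 0 -> q != 0 -> (enorm p)^-1 *: p != (enorm q)^-1 *: q ->
  exists v : 'rV[R]_d,
    \sum_i v ord0 i * p ord0 i < 0 /\ 0 < \sum_i v ord0 i * q ord0 i.
Proof.
move=> p0 q0 neq.
have p1 := sum_sqr_normalized _ _ p p0; have q1 := sum_sqr_normalized _ _ q q0.
set a := _ *: p in neq p1; set b := _ *: q in neq q1.
have pE i : p ord0 i = enorm p * a ord0 i by rewrite !mxE mulVKf// gt_eqF ?enorm_gt0.
have qE i : q ord0 i = enorm q * b ord0 i by rewrite !mxE mulVKf// gt_eqF ?enorm_gt0.
have : 0 < \sum_i (b - a) ord0 i ^+ 2 by apply: sum_sqr_gt0; rewrite subr_eq0 eq_sym.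
have -> : \sum_i (b - a) ord0 i ^+ 2
    = \sum_i a ord0 i ^+ 2 + \sum_i b ord0 i ^+ 2 - 2 * \sum_i a ord0 i * b ord0 i.
  rewrite mulr_sumr -big_split -sumrB/=; apply: eq_bigr => i _.
  by rewrite [(b - a) ord0 i]mxE [(- a) ord0 i]mxE; ring.
rewrite p1 q1 => ab0; have ab1 : \sum_i a ord0 i * b ord0 i < 1 by lra.
exists (b - a); split.
  have -> : \sum_i (b - a) ord0 i * p ord0 i = enorm p * (\sum_i a ord0 i * b ord0 i - 1).
    rewrite -p1 -sumrB mulr_sumr; apply: eq_bigr => i _.
    by rewrite [p ord0 i]pE [(b - a) ord0 i]mxE [(- a) ord0 i]mxE; ring.
  by rewrite pmulr_rlt0 ?enorm_gt0// subr_lt0.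
have -> : \sum_i (b - a) ord0 i * q ord0 i = enorm q * (1 - \sum_i a ord0 i * b ord0 i).
  rewrite -q1 -sumrB mulr_sumr; apply: eq_bigr => i _.
  by rewrite [q ord0 i]qE [(b - a) ord0 i]mxE [(- a) ord0 i]mxE; ring.
by rewrite pmulr_rgt0 ?enorm_gt0// subr_gt0.
Qed.

(** A separating direction descends for the chart of [g] while its opposite descends for the chart
    of [f]. Charts yield weak inequalities only; strict quasiconvexity makes them strict on a
    shorter vector. *)
Lemma crossing_direction (R : realType) (n : nat) (f g : 'rV[R]_n.+1 -> R)
    (x : 'rV[R]_n.+1) (phi psi : 'rV[R]_n.+1 -> R) (r s : R) :
  strictly_quasiconvex f -> strictly_quasiconvex g ->
  C1_chart [set z | f z <= f x] x phi r -> C1_chart [set z | g z <= g x] x psi s ->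
  (enorm (grad phi x))^-1 *: grad phi x != (enorm (grad psi x))^-1 *: grad psi x ->
  exists v, f (x - v) < f x /\ g (x + v) < g x.
Proof.
move=> fq gq chf chg neq.
have [_ _ _ gf0 _] := chf; have [_ _ _ gg0 _] := chg.
rewrite eq_sym in neq.
have [v [vg vf]] := separating_direction _ _ _ _ gg0 gf0 neq.
have v0 : v != 0.
  by apply: contraTneq vf => ->; rewrite big1 ?ltxx// => i _; rewrite mxE mul0r.
have [t t0 ft] : exists2 t, 0 < t & f (x + t *: - v) <= f x.
  apply: (chart_descent _ _ _ _ _ _ _ chf).
  rewrite -oppr_gt0 -sumrN; congr (0 < _): vf; apply: eq_bigr => i _.
  by rewrite !mxE mulNr opprK.
have [u u0 gu] : exists2 t, 0 < t & g (x + t *: v) <= g x.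
  apply: (chart_descent _ _ _ _ _ _ _ chg).
  by congr (_ < 0): vg; apply: eq_bigr => i _; rewrite mxE.
(* One length must suit both functions and be strictly shorter than [t] and [u]. *)
have [w w0 wtu] : exists2 w, 0 < w & w < t /\ w < u.
  exists (minr t u / 2); first by rewrite divr_gt0// lt_min t0.
  have m0 : 0 < minr t u by rewrite lt_min t0.
  have : minr t u / 2 < minr t u by rewrite ltr_pdivrMr// ltr_pMr// ltr1n.
  by move=> h; split; apply: lt_le_trans h _; rewrite ge_min lexx ?orbT.
exists (w *: v); split.
  rewrite -scalerN; apply: (strictly_quasiconvex_ray _ _ f x (- v) w t) => //.
    by rewrite oppr_eq0.
  by rewrite w0; case: wtu.
apply: (strictly_quasiconvex_ray _ _ g x v w u) => //.
by rewrite w0; case: wtu.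
Qed.

(** * Improvable pairs fill a cone *)

(* [y] is the target of [x] under the first map, [y'] that of [x'] under the second. *)
Definition improvable (R : realType) (d : nat) (c : 'rV[R]_d -> 'rV[R]_d -> R)
    (x x' y y' : 'rV[R]_d) : Prop :=
  c x' y < maxr (c x y) (c x' y') /\ c x y' < maxr (c x y) (c x' y').

Arguments improvable {R d}.

(** [q] bundles a target, a direction and a step. Letting target and direction vary near [(y, v)] is
    what gives a full cone, uniformly in nearby targets. The choice of [v] depends on which of
    [c x y] and [c x y'] is larger. *)
Lemma improvable_cone (R : realType) (n : nat)
    (c : 'rV[R]_n.+1 -> 'rV[R]_n.+1 -> R) (x y y' : 'rV[R]_n.+1) :
  continuous (fun p : 'rV[R]_n.+1 * 'rV[R]_n.+1 => c p.1 p.2) ->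
  (forall x y, 0 <= c x y) ->
  (forall x, exists! y, c x y = 0) ->
  (forall y, inf (range (fun x => c x y)) = 0) ->
  (forall y, strictly_quasiconvex (fun x => c x y)) ->
  (forall lam y, 0 < lam -> C1_boundary (sublevel c y lam)) ->
  (forall x y yt lam n, 0 < lam -> c x y = lam -> c x yt = lam ->
     outer_normal (sublevel c y lam) x n ->
     outer_normal (sublevel c yt lam) x n -> y = yt) ->
  y <> y' ->
  exists v : 'rV[R]_n.+1,
    \forall q \near (y, v, 0 : R), 0 < q.2 ->
      improvable c (x + q.2 *: q.1.2) x q.1.1 y'.
Proof.
move=> cc c0 cuniq cinf cq cC1 cnormal yy'.
have cont (U : topologicalType) (f g : U -> 'rV[R]_n.+1) (p : U) :
    {for p, continuous f} -> {for p, continuous g} ->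
    {for p, continuous (fun q => c (f q) (g q))}.
  move=> fc gc; have fgc : {for p, continuous (fun q => (f q, g q))}.
    exact: (@cvg_pair _ _ _ (nbhs p) (nbhs (f p)) (nbhs (g p)) _ _ _ f g fc gc).
  exact: (continuous_comp fgc (cc (f p, g p))).
pose U := ('rV[R]_n.+1 * 'rV[R]_n.+1 * R)%type.
have c1 (p : U) : {for p, continuous (fun q : U => q.1)}.
  exact: (@cvg_fst _ _ (nbhs p.1) (nbhs p.2)).
have c2 (p : U) : {for p, continuous (fun q : U => q.2)}.
  exact: (@cvg_snd _ _ (nbhs p.1) (nbhs p.2)).
have c11 (p : U) : {for p, continuous (fun q : U => q.1.1)}.
  exact: (continuous_comp (c1 p) (@cvg_fst _ _ (nbhs p.1.1) (nbhs p.1.2) _)).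
have c12 (p : U) : {for p, continuous (fun q : U => q.1.2)}.
  exact: (continuous_comp (c1 p) (@cvg_snd _ _ (nbhs p.1.1) (nbhs p.1.2) _)).
have cst (z : 'rV[R]_n.+1) (p : U) : {for p, continuous (fun q : U => z)}.
  exact: cvg_cst.
have cmove (p : U) : {for p, continuous (fun q : U => x + q.2 *: q.1.2)}.
  by apply: cvgD; [exact: cvg_cst|apply: cvgZ; [exact: c2|exact: c12]].
(* The assumption is an open condition on target and direction; each nearby pair then raises the
   cost on the opposite side of [x]. *)
have outward v : c (x - v) y < c x y ->
    \forall q \near ((y, v, 0) : U), 0 < q.2 ->
      c x q.1.1 < c (x + q.2 *: q.1.2) q.1.1.
  move=> cv; have : \forall q \near ((y, v, 0) : U), c (x - q.1.2) q.1.1 < c x q.1.1.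
    apply: near_lt; [|by apply: cont; [exact: cst|exact: c11]|exact: cv].
    by apply: cont; [apply: cvgB; [exact: cvg_cst|exact: c12]|exact: c11].
  apply: filterS => q /= h q0.
  exact: (strictly_quasiconvex_back _ _ (fun z => c z q.1.1)).
(* A drop at the full step 1 forces a drop at every shorter positive step. *)
have inward v : c (x + v) y' < c x y' ->
    \forall q \near ((y, v, 0) : U), 0 < q.2 -> c (x + q.2 *: q.1.2) y' < c x y'.
  move=> cv; have v1 : \forall q \near ((y, v, 0) : U), c (x + q.1.2) y' < c x y'.
    apply: near_lt; [|exact: cvg_cst|exact: cv].
    by apply: cont; [apply: cvgD; [exact: cvg_cst|exact: c12]|exact: cst].
  have v2 : \forall q \near ((y, v, 0) : U), q.2 < 1.
    by apply: near_lt => //=; exact: cvg_cst.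
  near=> q => q0.
  have cq1 : c (x + q.1.2) y' < c x y' by near: q.
  apply: (strictly_quasiconvex_ray _ _ (fun z => c z y') x q.1.2 q.2 1) => //.
  - by rewrite scale1r ltW.
  - by apply: contraTneq cq1 => ->; rewrite addr0 ltxx.
  - by rewrite q0/=; near: q.
have lower z : 0 < c x z -> exists w, c w z < c x z.
  move=> cxz; have : inf (range (fun w => c w z)) < c x z by rewrite cinf.
  have ne : range (fun w => c w z) !=set0 by exists (c x z), x.
  by move=> /(inf_lt ne)[_ [w _ <-] cw]; exists w.
have [lt|lt|eq] := ltgtP (c x y) (c x y').
(* The cost [c x y'] dominates: moving towards a point [w] cheaper for [y'] lowers it. *)
- have [w cw] := lower y' (le_lt_trans (c0 x y) lt).
  exists (w - x).
  have h1 := inward (w - x); rewrite addrC subrK in h1; have {}h1 := h1 cw.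
  have h2 : \forall q \near ((y, w - x, 0) : U), c x q.1.1 < c x y'.
    by apply: near_lt => //=; apply: cont => //; exact: c11.
  near=> q => q0; split; rewrite lt_max; apply/orP; right.
    by near: q.
  by move: q0; near: q.
(* The cost [c x y] dominates: moving away from a point [w] cheaper for [y] makes the moved point
   even costlier for targets near [y]. *)
- have [w cw] := lower y (le_lt_trans (c0 x y') lt).
  exists (x - w).
  have h1 := outward (x - w); rewrite opprB addrC subrK in h1; have {}h1 := h1 cw.
  have h2 : \forall q \near ((y, x - w, 0) : U),
      c (x + q.2 *: q.1.2) y' < c (x + q.2 *: q.1.2) q.1.1.
    apply: near_lt; [|apply: cont => //; exact: c11|by rewrite /= scale0r addr0].
    by apply: cont => //; exact: cst.
  near=> q => q0; split; rewrite lt_max; apply/orP; left.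
    by move: q0; near: q.
  by near: q.
(* Equal costs are positive, since two zeros of [c x] would give [y = y']. The normals then differ,
   and a crossing direction achieves both effects at once. *)
- have cpos : 0 < c x y.
    rewrite lt_neqAle c0 andbT; apply/eqP => cxy; apply: yy'.
    have [z [_ zuniq]] := cuniq x.
    by rewrite -(zuniq y) ?cxy// -(zuniq y') -?eq -?cxy.
  have chart z : c x z = c x y ->
      exists phi r, C1_chart (sublevel c z (c x y)) x phi r.
    move=> cz; apply: (cC1 _ _ cpos); first by apply: subset_closure; rewrite /sublevel/= cz.
    by rewrite /sublevel -cz; exact: (strictly_quasiconvex_not_interior _ _ (fun w => c w z)).
  have [phi [r chphi]] := chart y erefl.
  have [psi [s chpsi]] := chart y' (esym eq).
  have [v [v1 v2]] : exists v, c (x - v) y < c x y /\ c (x + v) y' < c x y'.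
    apply: (crossing_direction _ _ (fun z => c z y) (fun z => c z y') x phi psi r s) => //.
      by rewrite -eq.
    apply/eqP => nn; apply: yy'; apply: (cnormal x _ _ _ _ cpos erefl (esym eq)).
      by exists phi, r; split.
    by exists psi, s; split.
  exists v; have h1 := outward v v1; have h2 := inward v v2.
  near=> q => q0; split; rewrite lt_max; apply/orP.
    by left; move: q0; near: q.
  by right; move: q0; near: q.
Unshelve. all: by end_near. Qed.

(** * Lebesgue null sets *)

(* [N ^ n] cubes of side [O(1/N)] suffice to cover [E]. *)
Lemma lebesgue_null_lipschitz_graph (R : realType) (n : nat)
    (E : set 'rV[R]_n.+1) (p : 'rV[R]_n.+1 -> 'rV[R]_n) (M L : R) :
  0 < M -> 0 <= L -> (forall x, E x -> `|p x| < M) ->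
  (forall x x', E x -> E x' -> `|x - x'| <= L * `|p x - p x'|) ->
  lebesgue_null E.
Proof.
move=> M0 L0 pM pL eps eps0.
(* The boxes have side [2 * r = 4 * L * M / N], so the [N ^ n] of them have total volume
   [(4 * L * M) ^+ n.+1 / N]. *)
pose N := (Num.truncn ((4 * L * M) ^+ n.+1 / eps)).+1.
have N0 : 0 < N%:R :> R by rewrite ltr0n.
have NE : (4 * L * M) ^+ n.+1 / N%:R < eps.
  by rewrite ltr_pdivrMr// [eps * _]mulrC -ltr_pdivrMr// truncnS_gt.
pose h := 2 * M / N%:R; pose r := L * h.
have h0 : 0 < h by rewrite divr_gt0// mulr_gt0.
have r0 : 0 <= r by rewrite mulr_ge0// ltW.
pose cell (f : {ffun 'I_n -> 'I_N}) x :=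
  E x /\ forall i, (f i)%:R * h <= p x ord0 i + M <= ((f i)%:R + 1) * h.
have cellP x : E x -> exists f, cell f x.
  move=> Ex.
  have ge0 i : 0 <= p x ord0 i + M < 2 * M.
    have := le_lt_trans (coord_le_norm _ _ (p x) i) (pM x Ex).
    by rewrite ltr_norml => /andP[]; lra.
  have ge0' i : 0 <= (p x ord0 i + M) / h by rewrite divr_ge0 ?(ltW h0)//; case/andP: (ge0 i).
  have ltN i : (Num.truncn ((p x ord0 i + M) / h) < N)%N.
    rewrite truncn_lt_nat// ltr_pdivrMr//; rewrite /h mulrCA divff ?gt_eqF// mulr1.
    by case/andP: (ge0 i).
  exists [ffun i => Ordinal (ltN i)]; split => // i; rewrite ffunE/=.
  have := truncn_itv (ge0' i); rewrite ler_pdivlMr// ltr_pdivrMr// -natr1.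
  by move=> /andP[-> /ltW ->].
have cell_close f x x' : cell f x -> cell f x' -> `|x - x'| <= r.
  move=> [Ex fx] [Ex' fx']; apply: le_trans (pL x x' Ex Ex') _.
  apply: ler_wpM2l => //; apply/row_norm_leP; first exact: ltW.
  move=> i; rewrite !mxE ler_norml.
  by move: (fx i) (fx' i); rewrite mulrDl mul1r; lra.
pose s := enum {ffun 'I_n -> 'I_N}.
pose f0 : {ffun 'I_n -> 'I_N} := [ffun=> ord0].
(* An empty cell takes the default centre [0]; its extra box is included in the volume count. *)
pose z k := xget 0 (cell (nth f0 s k)).
(* Beyond the list of cells the boxes shrink to the point [0], of volume zero in positive
   dimension. *)
pose a k : 'rV[R]_n.+1 := if (k < size s)%N then z k - const_mx r else 0.
pose b k : 'rV[R]_n.+1 := if (k < size s)%N then z k + const_mx r else 0.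
exists a, b; split.
  move=> x Ex; have [f fx] := cellP x Ex.
  exists (index f s) => //.
  have fs : (index f s < size s)%N by rewrite index_mem mem_enum.
  rewrite /box/= /a /b fs /z nth_index ?mem_enum// => i.
  have fz : cell f (xget 0 (cell f)) by apply: xgetPex; exists x.
  have := le_trans (coord_le_norm _ _ _ i) (cell_close f _ _ fx fz).
  by rewrite !mxE ler_norml; lra.
have vol k : box_vol (a k) (b k) = if (k < size s)%N then (2 * r) ^+ n.+1 else 0.
  rewrite /box_vol /a /b; case: ifP => _.
    under eq_bigr do rewrite !mxE opprD opprK addrACA subrr add0r -mulr2n -mulr_natl.
    rewrite prodr_const cardT/= size_enum_ord.
    by rewrite (max_idPr _)// mulr_ge0.
  by rewrite big_ord_recl mxE subrr maxxx mul0r.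
rewrite (nneseries_split 0 (size s)); last first.
  move=> k _; rewrite lee_fin vol; case: ifP => // _.
  by rewrite exprn_ge0// mulr_ge0.
rewrite add0n eseries0 ?adde0; last first.
  by move=> k sk _; rewrite vol ltnNge sk.
rewrite sumEFin lte_fin.
rewrite (eq_big_nat _ _ (F2 := fun=> (2 * r) ^+ n.+1)); last first.
  by move=> k /andP[_ ks]; rewrite vol ks.
rewrite sumr_const_nat subn0 -cardE card_ffun !card_ord.
apply: le_lt_trans NE; rewrite -[leLHS]mulr_natr natrX.
have -> : 2 * r = 4 * L * M / N%:R by rewrite /r /h; field; rewrite gt_eqF.
rewrite expr_div_n exprS [N%:R ^+ n.+1]exprS invfM mulrA mulfVK//.
by rewrite expf_neq0// gt_eqF.
Qed.

(** [E] is a Lipschitz graph over its projection [p] along [w]: if [tau x x'] were large compared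
    with [p x - p x'], then [x' - x] would be almost parallel to [w] and [x'] would lie in the
    forbidden cone at [x]. The small diameter of [E] keeps the step below [r]. *)
Lemma lebesgue_null_cone_avoiding (R : realType) (n : nat)
    (E : set 'rV[R]_n.+1) (w z : 'rV[R]_n.+1) (r rho : R) :
  0 < r -> 0 < rho -> w ord0 ord0 != 0 -> 2 * rho < r * `|w ord0 ord0| ->
  (forall x, E x -> `|x - z| < rho) ->
  (forall x x' t u, E x -> E x' -> 0 < t < r -> `|w - u| < r -> x' <> x + t *: u) ->
  lebesgue_null E.
Proof.
move=> r0 rho0 w0 rhor Ez Eavoid.
pose tau (x x' : 'rV[R]_n.+1) : R := (x' ord0 ord0 - x ord0 ord0) / w ord0 ord0.
pose p (x : 'rV[R]_n.+1) : 'rV[R]_n :=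
  \row_i (x ord0 (lift ord0 i) - x ord0 ord0 / w ord0 ord0 * w ord0 (lift ord0 i)).
have aw0 : 0 < `|w ord0 ord0| by rewrite normr_gt0.
(* Removing [tau x x' *: w] kills the first coordinate and leaves the coordinates of [p x' - p x]
   elsewhere. *)
have shear x x' : `|x' - x - tau x x' *: w| <= `|p x - p x'|.
  apply/row_norm_leP => // i; have [j ->|->] := unliftP ord0 i.
    rewrite [X in `|X| <= _](_ : _ = - (p x - p x') ord0 j) ?normrN ?coord_le_norm//.
    by rewrite !mxE /tau; field.
  by rewrite !mxE /tau divfK// subrr normr0.
have tau_lt x x' : E x -> E x' -> `|tau x x'| < r.
  move=> Ex Ex'; rewrite /tau normrM normfV ltr_pdivrMr//.
  apply: le_lt_trans rhor.
  have -> : x' ord0 ord0 - x ord0 ord0 = (x' - z) ord0 ord0 - (x - z) ord0 ord0.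
    by rewrite !mxE; ring.
  apply: le_trans (ler_normB _ _) _.
  have := coord_le_norm _ _ (x' - z) ord0; have := coord_le_norm _ _ (x - z) ord0.
  by have := Ez _ Ex; have := Ez _ Ex'; lra.
have pos x x' : E x -> E x' -> 0 < tau x x' -> r * `|tau x x'| <= `|p x - p x'|.
  move=> Ex Ex' t0; apply: le_trans (shear x x'); rewrite leNgt; apply/negP => lt.
  have t_lt := tau_lt _ _ Ex Ex'; rewrite gtr0_norm// in t_lt lt.
  apply: (Eavoid x x' (tau x x') ((tau x x')^-1 *: (x' - x))) => //.
  - by rewrite t0.
  - rewrite -(ltr_pM2r t0) -[in X in _ * X](gtr0_norm t0) mulrC -normrZ.
    by rewrite scalerBr scalerA divff ?gt_eqF// scale1r -normrN opprB.
  - by rewrite scalerA divff ?gt_eqF// scale1r addrC subrK.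
have all x x' : E x -> E x' -> r * `|tau x x'| <= `|p x - p x'|.
  move=> Ex Ex'; have [lt|lt|<-] := ltgtP 0 (tau x x').
  - exact: pos.
  - have tauN : tau x x' = - tau x' x by rewrite /tau -mulNr opprB.
    by rewrite tauN normrN [X in _ <= X]distrC; apply: pos => //; rewrite -oppr_lt0 -tauN.
  - by rewrite normr0 mulr0.
(* [k] bounds the norm of the linear map [p]. *)
pose k := 1 + `|w ord0 ord0|^-1 * `|w|.
have k0 : 0 <= k by rewrite addr_ge0// mulr_ge0// invr_ge0.
pose M := (`|z| + rho) * k + 1.
have M0 : 0 < M by apply: ltr_wpDl => //; rewrite mulr_ge0// addr_ge0// ltW.
apply: (lebesgue_null_lipschitz_graph _ _ _ p M (1 + `|w| / r)) => //.
- by rewrite addr_ge0// divr_ge0// ltW.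
- move=> x Ex.
  have xz : `|x| <= `|z| + rho.
    rewrite -[x](subrK z) addrC; apply: le_trans (ler_normD _ _) _.
    by rewrite lerD2l ltW// Ez.
  apply: (@le_lt_trans _ _ (`|x| * k)).
    apply/row_norm_leP; first exact: mulr_ge0.
    move=> i; rewrite !mxE; apply: le_trans (ler_normB _ _) _.
    rewrite mulrDr mulr1 lerD ?coord_le_norm// !normrM normfV mulrA.
    apply: ler_pM; rewrite ?coord_le_norm//; last by rewrite ler_wpM2r ?invr_ge0 ?coord_le_norm.
  by rewrite /M ltr_pwDr// ler_wpM2r.
- move=> x x' Ex Ex'; have := shear x' x; have := all x' x Ex' Ex.
  rewrite [`|p x' - _|]distrC => h1 h2.
  have -> : x - x' = (x - x' - tau x' x *: w) + tau x' x *: w by rewrite subrK.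
  apply: le_trans (ler_normD _ _) _; rewrite mulrDl mul1r lerD// normrZ.
  by rewrite [leLHS]mulrC -mulrA ler_wpM2l// ler_pdivlMl.
Qed.

(** * Negligible exceptional sets *)

Lemma box_measurable (R : realType) (d : nat) (a b : 'rV[R]_d) :
  measurable (box a b : set (borelRd R d)).
Proof.
have -> : box a b = ~` (~` box a b) by rewrite setCK.
apply: measurableC; apply: sub_sigma_algebra; apply: closed_openC.
have -> : box a b = \bigcap_(i in [set: 'I_d])
    (fun x : 'rV[R]_d => x ord0 i) @^-1` [set` `[a ord0 i, b ord0 i]].
  apply/seteqP; split => x xab i; first by move=> _; rewrite /= in_itv/=; exact: xab.
  by have := xab i I; rewrite /= in_itv.
apply: closed_bigI => i _; apply: preimage_closed; last exact: itv_closed.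
by move=> x _; exact: coord_continuous.
Qed.

(** Absolute continuity concerns measurable sets, so [E] is first enlarged to a measurable null set,
    the intersection of coverings of volume below [1 / (m + 1)]. *)
Lemma lebesgue_null_negligible (R : realType) (d : nat)
    (mu : probability (borelRd R d) R) (E : set 'rV[R]_d) :
  abs_cont_lebesgue mu -> lebesgue_null E -> mu.-negligible E.
Proof.
move=> ac E0.
have /choice[a /choice[b ab]] (m : nat) : exists a b : nat -> 'rV[R]_d,
    E `<=` \bigcup_k box (a k) (b k) /\
    (\sum_(0 <= k <oo) (box_vol (a k) (b k))%:E < (m.+1%:R^-1)%:E)%E.
  by apply: E0; rewrite invr_gt0.
pose F := \bigcap_m \bigcup_k box (a m k) (b m k).
exists F; split.
- by apply: bigcapT_measurable => m; apply: bigcupT_measurable => k; exact: box_measurable.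
- apply: ac.
    by apply: bigcapT_measurable => m; apply: bigcupT_measurable => k; exact: box_measurable.
  move=> eps eps0; exists (a (Num.truncn eps^-1)), (b (Num.truncn eps^-1)).
  split; first by move=> x; apply.
  apply: lt_trans (ab _).2 _; rewrite lte_fin invf_plt ?posrE//.
  exact: truncnS_gt.
- by move=> x Ex m _; exact: (ab m).1.
Qed.

(** Each coordinate is approximated from the side away from zero; a nonzero first coordinate is what
    projecting along a rational direction requires. *)
Lemma rat_row_dense (R : realType) (d : nat) (v : 'rV[R]_d) (eps : R) :
  0 < eps -> exists q : 'rV[rat]_d,
    `|v - map_mx ratr q| < eps /\ forall i, (map_mx ratr q : 'rV[R]_d) ord0 i != 0.
Proof.
move=> eps0.
have /choice[q qP] (i : 'I_d) : exists q : rat,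
    `|v ord0 i - ratr q| <= eps / 2 /\ (ratr q : R) != 0.
  have e2 : 0 < eps / 2 by rewrite divr_gt0.
  have [v0|v0] := leP 0 (v ord0 i).
    have [q] := @rat_in_itvoo _ (v ord0 i) (v ord0 i + eps / 2) ltac:(by rewrite ltrDl).
    rewrite in_itv/= => /andP[q1 q2]; exists q; split; last by rewrite gt_eqF// (le_lt_trans v0).
    by rewrite ler_norml; lra.
  have [q] := @rat_in_itvoo _ (v ord0 i - eps / 2) (v ord0 i) ltac:(by rewrite gtrBl).
  rewrite in_itv/= => /andP[q1 q2]; exists q; split; last by rewrite lt_eqF// (lt_trans q2).
  by rewrite ler_norml; lra.
exists (\row_i q i); split; last by move=> i; rewrite !mxE (qP i).2.
apply: (@le_lt_trans _ _ (eps / 2)); last by rewrite ltr_pdivrMr// ltr_pMr// ltr1n.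
apply/row_norm_leP => [|i]; first by rewrite divr_ge0// ltW.
by rewrite !mxE (qP i).1.
Qed.

(* The exceptional points with prescribed rational tolerances form a set avoiding
   cones, hence a null set. *)
Lemma negligible_no_partner (R : realType) (n : nat)
    (mu : probability (borelRd R n.+1) R) (T : 'rV[R]_n.+1 -> 'rV[R]_n.+1)
    (S : set 'rV[R]_n.+1) (P : 'rV[R]_n.+1 -> 'rV[R]_n.+1 -> 'rV[R]_n.+1 -> Prop) :
  abs_cont_lebesgue mu ->
  (forall x, S x -> exists v : 'rV[R]_n.+1,
     \forall q \near (T x, v, 0 : R), 0 < q.2 -> P x (x + q.2 *: q.1.2) q.1.1) ->
  mu.-negligible [set x | S x /\ forall x', S x' -> ~ P x x' (T x')].
Proof.
move=> ac SP; set B := [set x | _].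
pose rv (q : 'rV[rat]_n.+1) : 'rV[R]_n.+1 := map_mx ratr q.
pose par : countType := ('rV[rat]_n.+1 * 'rV[rat]_n.+1 * 'rV[rat]_n.+1 * nat)%type.
(* [q], [w] and [z] approximate the target, the direction and the point, and [r] is the common
   tolerance. *)
pose F (a : par) : set 'rV[R]_n.+1 :=
  let: (q, w, z, m) := a in let r := m.+1%:R^-1 in
  [set x | [/\ B x, `|T x - rv q| < r, rv w ord0 ord0 != 0,
      `|x - rv z| < r * `|rv w ord0 ord0| / 4 &
      forall y u t, `|y - rv q| < r -> `|rv w - u| < r -> 0 < t < r ->
        P x (x + t *: u) y]].
have F0 a : mu.-negligible (F a).
  case: a => [[[q w] z] m].
  have [w0|w0] := eqVneq (rv w ord0 ord0) 0.
    suff -> : F (q, w, z, m) = set0 by exact: negligible_set0.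
    by apply/seteqP; split => // x [_ _]; rewrite w0 eqxx.
  apply: lebesgue_null_negligible => //.
  have r0 : 0 < m.+1%:R^-1 :> R by rewrite invr_gt0.
  have rw0 : 0 < m.+1%:R^-1 * `|rv w ord0 ord0| by rewrite mulr_gt0// normr_gt0.
  apply: (lebesgue_null_cone_avoiding _ _ _ (rv w) (rv z) (m.+1%:R^-1)
    (m.+1%:R^-1 * `|rv w ord0 ord0| / 4)) => //.
  - by rewrite divr_gt0.
  - by move: rw0; move: (_ * _) => A A0; lra.
  - by move=> x [].
  (* A point [x'] of the same piece in the cone at [x] has its target within tolerance, hence would
     be a partner of [x]. *)
  - move=> x x' t u [[_ Bx] _ _ _ xP] [[Sx' _] Tx' _ _ _] t0 wu x'E.
    by apply: (Bx x' Sx'); rewrite {1}x'E; exact: xP.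
pose F' k := if unpickle k is Some a then F a else set0.
suff sub : B `<=` \bigcup_k F' k.
  apply: (@negligibleS _ (borelRd R n.+1) R mu _ _ sub).
  apply: (@negligible_bigcup _ (borelRd R n.+1) R mu F') => k; rewrite /F'; case: unpickle => [a|]; first exact: F0.
  exact: negligible_set0.
move=> x Bx; have [v] := SP x Bx.1.
case/nbhs_ballP => e /= e0 eP.
(* With [r < e / 2], being close to the rational data implies being within [e] of the true data. *)
pose m := Num.truncn (e / 2)^-1; pose r : R := m.+1%:R^-1.
have r0 : 0 < r by rewrite invr_gt0.
have re : r < e / 2 by rewrite /r invf_plt ?posrE ?divr_gt0// truncnS_gt.
have e2 : 0 < e / 2 by rewrite divr_gt0.
have [w [vw w0]] := rat_row_dense _ _ v (e / 2) e2.
have [q [Tq _]] := rat_row_dense _ _ (T x) r r0.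
have rw0 : 0 < r * `|rv w ord0 ord0| / 4 by rewrite divr_gt0// mulr_gt0// normr_gt0.
have [z [xz _]] := rat_row_dense _ _ x _ rw0.
suff Fx : F (q, w, z, m) x.
  by exists (pickle ((q, w, z, m) : par)); [exact: I|rewrite /F' pickleK; exact: Fx].
split; [exact: Bx|exact: Tq|exact: w0|exact: xz|].
move=> y u t yq wu /andP[t0 tr]; apply: (eP (y, u, t)) => //.
split; first split; rewrite /= -?ball_normE/=.
- rewrite -(subrK (rv q) (T x)) -addrA; apply: le_lt_trans (ler_normD _ _) _.
  rewrite [e]splitr ltrD//; first exact: lt_trans re.
  by rewrite distrC; exact: lt_trans re.
- rewrite -(subrK (rv w) v) -addrA; apply: le_lt_trans (ler_normD _ _) _.
  by rewrite [e]splitr ltrD//; exact: lt_trans re.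
- by have := lt_trans tr re; rewrite sub0r normrN gtr0_norm//; lra.
Qed.

(** * Absence of closed chains *)

(* The rotation [x i -> y (i + 1)] and its inverse on the other plan: each would
   bound the larger of the two maximal costs by something strictly smaller. *)
Lemma no_improvable_cycle (R : realType) (d : nat)
    (c : 'rV[R]_d -> 'rV[R]_d -> R) (G Gt : set ('rV[R]_d * 'rV[R]_d))
    (k : nat) (x x' y y' : 'I_k.+1 -> 'rV[R]_d) :
  (forall x y, 0 <= c x y) ->
  inf_c_cyc_mon_set c G -> inf_c_cyc_mon_set c Gt ->
  (forall i, G (x i, y i)) -> (forall i, Gt (x' i, y' i)) ->
  (forall i, c (x' (ordS i)) (y' i)
     < maxr (c (x (ordS i)) (y (ordS i))) (c (x' (ordS i)) (y' (ordS i)))) ->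
  (forall i, c (x i) (y (ordS i)) < maxr (c (x i) (y i)) (c (x' i) (y' i))) ->
  False.
Proof.
move=> c0 cmG cmGt Gxy Gxy' in_lt out_lt.
have := cmG _ (fun i => (x i, y i)) (perm (@ordS_inj k.+1)) Gxy.
have := cmGt _ (fun i => (x' i, y' i)) (perm (@ord_pred_inj k.+1)) Gxy'.
rewrite /=; set M' := (X in X <= _); set N' := (X in _ <= X) => le'.
set M := (X in X <= _); set N := (X in _ <= X) => le.
have le_max i : maxr (c (x i) (y i)) (c (x' i) (y' i)) <= maxr M M'.
  rewrite ge_max !le_max; apply/andP; split; apply/orP; [left|right].
    exact: (le_bigmax _ (fun i => c (x i) (y i))).
  exact: (le_bigmax _ (fun i => c (x' i) (y' i))).
(* The big maxima start from the default [0], so bounding them strictly requires a positive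
   bound. *)
have max0 : 0 < maxr M M'.
  by apply: le_lt_trans (c0 _ _) (lt_le_trans (out_lt ord0) (le_max ord0)).
have N_lt : N < maxr M M'.
  apply: bigmax_lt => // i _; rewrite permE.
  exact: lt_le_trans (out_lt i) (le_max i).
have N'_lt : N' < maxr M M'.
  apply: bigmax_lt => // i _; rewrite permE -{1}(ord_predK i).
  apply: lt_le_trans (in_lt (ord_pred i)) _; rewrite ord_predK.
  exact: le_max.
(* Both [M] and [M'] are now strictly below the larger of the two. *)
have := le_lt_trans le N_lt; have := le_lt_trans le' N'_lt.
by rewrite !lt_max !ltxx orbF/= => h1 h2; have := lt_trans h1 h2; rewrite ltxx.
Qed.

(** * Measurability and balance of mass *)

Lemma open_measurable_borelRd (R : realType) (d : nat) (A : set 'rV[R]_d) :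
  open A -> measurable (A : set (borelRd R d)).
Proof. exact: sub_sigma_algebra. Qed.

Lemma set1_measurable_borelRd (R : realType) (d : nat) (y : 'rV[R]_d) :
  measurable ([set y] : set (borelRd R d)).
Proof.
rewrite -[X in measurable X]setCK; apply: measurableC.
apply: open_measurable_borelRd; apply: closed_openC.
apply: accessible_closed_set1; apply: hausdorff_accessible; exact: norm_hausdorff.
Qed.

Lemma negligible_off_graph (R : realType) (d : nat)
    (mu : probability (borelRd R d) R)
    (gamma : probability (borelRd R d * borelRd R d)%type R)
    (T : borelRd R d -> borelRd R d) (G : set ('rV[R]_d * 'rV[R]_d)) :
  measurable_fun setT T ->
  (forall E : set (borelRd R d * borelRd R d), measurable E ->
     gamma E = mu ((fun x => (x, T x)) @^-1` E)) ->
  gamma.-negligible (~` G) -> mu.-negligible [set x | ~ G (x, T x)].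
Proof.
move=> mT gammaE [N [mN N0 GN]].
exists ((fun x => (x, T x)) @^-1` N); split.
- have mf : measurable_fun setT (fun x : borelRd R d => (x, T x)).
    by apply: measurable_fun_pair => //; exact: measurable_id.
  by rewrite -[X in measurable X]setTI; exact: mf.
- by rewrite -gammaE.
- by move=> x Gx; exact: GN.
Qed.

Lemma no_mass_leaves (R : realType) (d : nat)
    (mu : probability (borelRd R d) R) (T Tt : borelRd R d -> borelRd R d)
    (y0 : 'rV[R]_d) (V : set (borelRd R d)) :
  measurable_fun setT T -> measurable_fun setT Tt ->
  (forall A : set (borelRd R d), measurable A -> mu (T @^-1` A) = mu (Tt @^-1` A)) ->
  measurable V -> ~ V y0 ->
  mu.-negligible [set x | (V (T x) \/ (T x = y0 /\ Tt x <> y0)) /\ ~ V (Tt x)] ->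
  mu (T @^-1` [set y0] `\` Tt @^-1` [set y0]) = 0%E.
Proof.
move=> mT mTt TTt mV Vy0 [N [mN N0 subN]].
have mpre (S : borelRd R d -> borelRd R d) A :
    measurable_fun setT S -> measurable A -> measurable (S @^-1` A).
  by move=> mS mA; rewrite -[X in measurable X]setTI; exact: mS.
set A := _ `\` _.
have mA : measurable A.
  by apply: measurableD; apply: mpre => //; exact: set1_measurable_borelRd.
have mTV := mpre _ _ mT mV; have mTtV := mpre _ _ mTt mV.
have disj : T @^-1` V `&` A = set0.
  by apply/seteqP; split => // x [/= VT [/= Ty0 _]]; apply: Vy0; rewrite -Ty0.
have le : (mu (T @^-1` V) + mu A <= mu (T @^-1` V))%E.
  rewrite -measureU// [leRHS]TTt// -(measureU0 mTtV mN N0).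
  apply: le_measure.
  - by apply: mem_set; apply: measurableU.
  - by apply: mem_set; apply: measurableU.
  - move=> x TVA; have [VTt|nVTt] := pselect (V (Tt x)); first by left.
    by right; apply: subN; split.
apply/eqP; rewrite eq_le measure_ge0 andbT.
by move: le; rewrite -[leRHS]adde0 leeD2lE// fin_num_measure.
Qed.

(** * Chains starting at [y0] *)

Lemma atom_preimage_unique (R : realType) (n : nat)
  (mu : probability (borelRd R n.+1) R)
  (c : 'rV[R]_n.+1 -> 'rV[R]_n.+1 -> R)
  (y0 : 'rV[R]_n.+1)
  (T Tt : borelRd R n.+1 -> borelRd R n.+1)
  (G Gt : set ('rV[R]_n.+1 * 'rV[R]_n.+1)) :
  abs_cont_lebesgue mu ->
  continuous (fun p : 'rV[R]_n.+1 * 'rV[R]_n.+1 => c p.1 p.2) ->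
  (forall x y, 0 <= c x y) ->
  (forall x, exists! y, c x y = 0) ->
  (forall y, inf (range (fun x => c x y)) = 0) ->
  (forall y, strictly_quasiconvex (fun x => c x y)) ->
  (forall lam y, 0 < lam -> C1_boundary (sublevel c y lam)) ->
  (forall x y yt lam n, 0 < lam -> c x y = lam -> c x yt = lam ->
     outer_normal (sublevel c y lam) x n ->
     outer_normal (sublevel c yt lam) x n -> y = yt) ->
  measurable_fun setT T -> measurable_fun setT Tt ->
  (forall A : set (borelRd R n.+1), measurable A ->
     mu (T @^-1` A) = mu (Tt @^-1` A)) ->
  inf_c_cyc_mon_set c G -> inf_c_cyc_mon_set c Gt ->
  mu.-negligible [set x | ~ G (x, T x)] -> mu.-negligible [set x | ~ Gt (x, Tt x)] ->
  mu (T @^-1` [set y0] `\` Tt @^-1` [set y0]) = 0%E.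
Proof.
move=> ac cc c0 cuniq cinf cq cC1 cnormal mT mTt TTt cmG cmGt negG negGt.
pose P := ('rV[R]_n.+1 * 'rV[R]_n.+1)%type.
pose mx (p : P) := maxr (c p.1 (T p.1)) (c p.2 (Tt p.2)).
pose ok (p : P) := [/\ G (p.1, T p.1), Gt (p.2, Tt p.2) &
  improvable c p.1 p.2 (T p.1) (Tt p.2)].
(* These are improvability inequalities of [q] and [p] with the targets [T q.1] and [Tt p.2]
   interchanged; they hold when the two targets are close enough. *)
pose link (p q : P) := c q.2 (Tt p.2) < mx q /\ c p.1 (T q.1) < mx p.
pose reach (p : P) := exists k (f : nat -> P), [/\ T (f 0%N).1 = y0, f k = p,
  forall i, (i <= k)%N -> ok (f i) & forall i, (i < k)%N -> link (f i) (f i.+1)].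
have reach_start p : ok p -> T p.1 = y0 -> reach p.
  by move=> okp py0; exists 0%N, (fun=> p); split.
have reach_step p q : reach p -> ok q -> link p q -> reach q.
  move=> [k [f [f0 fk fok flink]]] okq pq.
  exists k.+1, (fun i => if (i <= k)%N then f i else q); split => //.
  - by rewrite ltnn.
  - by move=> i _; case: ifP => [ik|_ //]; exact: fok.
  - move=> i; rewrite ltnS => ik; rewrite ik; case: (ltnP i k) => [lt|ki].
      exact: flink.
    have -> : i = k by apply/eqP; rewrite eqn_leq ik ki.
    by rewrite fk.
have reach_ok p : reach p -> ok p by move=> [k [f [_ <- fok _]]]; exact: fok.
(* A chain ending at [y0] closes up: its last and first targets coincide, so the closing link is
   improvability itself. *)
have reach_y0 p : reach p -> Tt p.2 <> y0.
  move=> [k [f [f0 fk fok flink]]] py0.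
  have clink (i : 'I_k.+1) : link (f i) (f (ordS i)).
    rewrite /=; have := ltn_ord i; rewrite ltnS leq_eqVlt => /orP[/eqP ik|ik].
      rewrite ik modnn fk; split; rewrite ?py0 ?f0.
        by have [_ _ [h _]] := fok 0%N isT; rewrite -f0.
      by have [_ _ [_ h]] := fok k (leqnn k); rewrite -py0 -fk.
    by rewrite modn_small ?ltnS//; exact: flink.
  apply: (no_improvable_cycle _ _ c G Gt k (fun i => (f i).1) (fun i => (f i).2)
    (fun i => T (f i).1) (fun i => Tt (f i).2)) => // i.
  - by have [] := fok i (ltn_ord i).
  - by have [] := fok i (ltn_ord i).
  - by have [] := clink i.
  - by have [] := clink i.
have c_open x a : open [set v | c x v < a].
  rewrite openE => v cv; have cxv : {for v, continuous (c x)}.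
    have fc : {for v, continuous (fun w : 'rV[R]_n.+1 => (x, w))}.
      exact: (@cvg_pair _ _ _ (nbhs v) (nbhs x) (nbhs v) _ _ _ (fun=> x) id
        (cvg_cst _) cvg_id).
    exact: (continuous_comp fc (cc (x, v))).
  have cst : {for v, continuous (fun=> a : R)} by exact: cst_continuous.
  exact: (near_lt _ _ _ _ v cxv cst cv).
(* The values accumulated, within the tolerances that allow a further link, by the
   chains starting at [y0]. *)
pose O (m : nat) := \bigcup_(p in reach)
  (ball (Tt p.2 : 'rV[R]_n.+1) m.+1%:R^-1 `&` [set v | c p.1 v < mx p]).
pose V : set (borelRd R n.+1) := (\bigcap_m O m) `&` ~` [set y0].
(* No measurability of [reach] enters: [O m] is open as a union of open sets, however large the
   family. *)
have mV : measurable V.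
  apply: measurableI; last by apply: measurableC; exact: set1_measurable_borelRd.
  apply: bigcapT_measurable => m; apply: open_measurable_borelRd.
  apply: bigcup_open => p _; apply: openI; last exact: c_open.
  exact: ball_open.
apply: (no_mass_leaves _ _ _ _ _ _ V) => //; first by case=> _; exact.
(* Improvability of [q] tolerates an error [e] in the target; [O m] with [1 / (m + 1) < e] supplies
   a chain ending that close to [T q.1]. *)
have reach_V q : ok q -> V (T q.1) -> reach q.
  move=> okq [Vq _]; have [_ _ [q1 q2]] := okq.
  have /nbhs_ballP[e /= e0 eP] := open_nbhs_nbhs (conj (c_open q.2 (mx q)) q1).
  have [p rp [pq1 pq2]] := Vq (Num.truncn e^-1) I.
  apply: (reach_step p) => //; split => //; apply: eP.
  move: pq1; rewrite -!ball_normE/= distrC => /lt_trans; apply.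
  by rewrite invf_plt ?posrE// truncnS_gt.
pose S : set 'rV[R]_n.+1 := [set x | [/\ G (x, T x), Gt (x, Tt x), Tt x <> T x &
  V (T x) \/ T x = y0]].
have negB := negligible_no_partner _ _ _ T S
  (fun x a y => improvable c a x y (Tt x)) ac.
(* Outside the null sets off the graphs, a point violating the balance condition lies in [S]. A
   partner [a] in [S] would make [(a, x)] reachable and put [Tt x] in [V], so there is none. *)
apply: (@negligibleS _ _ _ mu _ _ _ (negligibleU (negligibleU negG negGt) (negB _))).
  move=> x [VT nV]; have [Gx|] := pselect (G (x, T x)); last by left; left.
  have [Gtx|] := pselect (Gt (x, Tt x)); last by left; right.
  have TtT : Tt x <> T x.
    by move=> E; move: VT nV; rewrite E => -[//|[-> /(_ erefl)]].
  right; split; first by split => //; case: VT => [|[? _]]; [left|right].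
  move=> a [Ga _ _ Ta] imp; apply: nV.
  have okp : ok (a, x) by split.
  have rp : reach (a, x) by case: Ta => Ta; [exact: reach_V|exact: reach_start].
  split; last exact: (reach_y0 _ rp).
  move=> m _; exists (a, x) => //; split; first by apply: ballxx; rewrite invr_gt0.
  by case: imp.
by move=> x [_ _ TtT _]; apply: improvable_cone => // E; apply: TtT.
Qed.

Theorem theorem3p3 (R : realType) (d : nat)
  (mu nu : probability (borelRd R d) R)
  (c : 'rV[R]_d -> 'rV[R]_d -> R)
  (y0 : 'rV[R]_d)
  (T Tt : borelRd R d -> borelRd R d)
  (gamma gammat : probability (borelRd R d * borelRd R d)%type R) :
  compact (msupport mu) -> compact (msupport nu) ->
  abs_cont_lebesgue mu ->
  continuous (fun p : 'rV[R]_d * 'rV[R]_d => c p.1 p.2) ->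
  (forall x y, 0 <= c x y) ->
  (* (i) *)
  (forall x, exists! y, c x y = 0) ->
  (forall y, inf (range (fun x => c x y)) = 0) ->
  (* (ii) *)
  (forall y, strictly_quasiconvex (fun x => c x y)) ->
  (* (iii) *)
  (forall lam y, 0 < lam -> C1_boundary (sublevel c y lam)) ->
  (* (iv) *)
  (forall x y yt lam n, 0 < lam -> c x y = lam -> c x yt = lam ->
     outer_normal (sublevel c y lam) x n ->
     outer_normal (sublevel c yt lam) x n -> y = yt) ->
  (0 < nu [set y0])%E ->
  (* T, Tt: Borel maps pushing mu to nu *)
  measurable_fun setT T -> measurable_fun setT Tt ->
  (forall A : set (borelRd R d), measurable A -> mu (T @^-1` A) = nu A) ->
  (forall A : set (borelRd R d), measurable A -> mu (Tt @^-1` A) = nu A) ->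
  (* gamma = (Id x T)#mu, gammat = (Id x Tt)#mu *)
  (forall E : set (borelRd R d * borelRd R d), measurable E ->
     gamma E = mu ((fun x => (x, T x)) @^-1` E)) ->
  (forall E : set (borelRd R d * borelRd R d), measurable E ->
     gammat E = mu ((fun x => (x, Tt x)) @^-1` E)) ->
  (* optimality among plans in Pi(mu,nu) *)
  (forall g : probability (borelRd R d * borelRd R d)%type R,
     is_plan mu nu g -> (cost_esssup c gamma <= cost_esssup c g)%E) ->
  (forall g : probability (borelRd R d * borelRd R d)%type R,
     is_plan mu nu g -> (cost_esssup c gammat <= cost_esssup c g)%E) ->
  (* infinity-c-cyclical monotonicity *)
  inf_c_cyc_mon_plan c gamma -> inf_c_cyc_mon_plan c gammat ->
  mu (T @^-1` [set y0] `\` Tt @^-1` [set y0]) = 0%E.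
Proof.
move=> _ _ ac cc c0 cuniq cinf cq cC1 cnormal _ mT mTt Tnu Ttnu gammaE gammatE _ _.
move=> [G [cmG negG]] [Gt [cmGt negGt]].
case: d => [|n] in mu nu c y0 T Tt gamma gammat ac cc c0 cuniq cinf cq cC1 cnormal
  mT mTt Tnu Ttnu gammaE gammatE G Gt cmG negG cmGt negGt *.
  (* In dimension zero there is a single point, so [Tt x] always equals [y0]. *)
  rewrite (_ : _ `\` _ = set0) ?measure0//.
  by apply/seteqP; split => // x [_]; apply; rewrite /= (thinmx0 (Tt x)) (thinmx0 y0).
apply: (atom_preimage_unique _ _ _ c _ _ _ G Gt) => //.
- by move=> A mA; rewrite Tnu// Ttnu.
- exact: (negligible_off_graph _ _ _ gamma).
- exact: (negligible_off_graph _ _ _ gammat).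
Qed.
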